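(* Let $f:[0,1]\to\mathbb R$ be an increasing integrable function, and suppose that $$\int_0^1 f(x)\,dx=0.$$ If $\phi:\mathbb R\to\mathbb R$ is odd and is increasing and convex on $[0,\infty)$, then $$\int_0^1 \phi\bigl(xf(x)\bigr)\,dx\geq 0.$$
   Context: ''Increasing'' is meant in the non-strict sense ($x\le y$ implies $f(x)\le f(y)$, and likewise for $\phi$ on $[0,\infty)$). *)

(* Defs.v *)
From mathcomp Require Export all_boot all_order all_algebra.
From mathcomp Require Export all_classical all_reals all_analysis.

(* Main.v *)
(** Let [c] be the point where [f] changes sign and [M] the integral of [f] over
    [[c, 1]], so that [- M] is the integral over [[0, c]].  For [x <= c],
    monotonicity gives [- x f(x) <= M], hence [phi (x f(x)) >= - phi M] there.
    Put [q := max c (1 - c)].  On [[q, 1]] we have [x f(x) >= q f(x)], and a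
    support line of [phi] at [M], of slope [s], bounds [phi (x f(x))] below by
    [phi M + s (q f(x) - M)].  Since [f] is increasing, [q] times the integral
    of [f] over [[q, 1]] is at least [c M], so the whole integral is at least
    [(c + q - 1) (s M - phi M)], which is nonnegative because [c + q >= 1] and,
    evaluating the support line at [0], [phi M <= s M]. *)

From mathcomp Require Import ring lra measurable_realfun.
Require Import Defs.

Set Implicit Arguments.
Unset Strict Implicit.

Import Order.TTheory GRing.Theory Num.Theory.
Import numFieldNormedType.Exports.
Local Open Scope classical_set_scope.
Local Open Scope ring_scope.

(** The weight of [x] in the convex combination giving [m] is [(y - m) / (y - x)]. Clearing
    denominators leaves a form from which chord slopes on either side of [m] can be compared. *)
Lemma convex_function_three_points (R : realType) (g : R -> R) (x m y : R) :
  convex_function (`[0, +oo[%classic : set R) g ->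
  0 <= x -> x < m -> m < y ->
  (y - x) * g m <= (y - m) * g x + (m - x) * g y.
Proof.
move=> g_convex x0 xm my.
have yx : 0 < y - x by lra.
have t0 : 0 <= (y - m) / (y - x) by apply: divr_ge0; lra.
have t1 : (y - m) / (y - x) <= 1 by rewrite ler_pdivrMr //; lra.
have g_conv : g ((y - m) / (y - x) * x + (1 - (y - m) / (y - x)) * y) <=
    (y - m) / (y - x) * g x + (1 - (y - m) / (y - x)) * g y.
  by apply: (g_convex (Itv01 t0 t1)); rewrite inE /= in_itv /= andbT; lra.
move: g_conv.
have -> : (y - m) / (y - x) * x + (1 - (y - m) / (y - x)) * y = m.
  by field; lra.
have -> : (y - m) / (y - x) * g x + (1 - (y - m) / (y - x)) * g y =
    ((y - m) * g x + (m - x) * g y) / (y - x) by field; lra.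
by rewrite ler_pdivlMr // mulrC.
Qed.

(** The slope is the supremum of the slopes of chords ending at [m] from the left. By the
    three-point inequality every chord slope to the right of [m] bounds them above; [0 < m] ensures
    that there is a left chord. *)
Lemma convex_function_support (R : realType) (g : R -> R) (m : R) :
  convex_function (`[0, +oo[%classic : set R) g -> 0 < m ->
  exists s, forall y, 0 <= y -> g m + s * (y - m) <= g y.
Proof.
move=> g_convex m0.
pose S := [set (g m - g x) / (m - x) | x in [set x | 0 <= x < m]].
have slope_le y : m < y -> ubound S ((g y - g m) / (y - m)).
  move=> my _ [x /= /andP[x0 xm] <-].
  have mx : 0 < m - x by lra.
  have ym : 0 < y - m by lra.
  rewrite ler_pdivrMr // mulrAC ler_pdivlMr //.
  by have := convex_function_three_points g_convex x0 xm my; lra.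
have S0 : S !=set0 by exists ((g m - g 0) / (m - 0)); exists 0; rewrite //= lexx.
have hsS : has_sup S by split=> //; exists ((g (m + 1) - g m) / (m + 1 - m)); apply: slope_le; lra.
exists (sup S) => y y0; have [ym|my|->] := ltgtP y m; last by rewrite subrr mulr0 addr0.
- have : (g m - g y) / (m - y) <= sup S.
    by apply: ub_le_sup; [case: hsS|exists y => //=; rewrite y0 ym].
  by rewrite ler_pdivrMr; lra.
- have := ge_sup S0 (slope_le y my).
  by rewrite ler_pdivlMr; lra.
Qed.

Lemma monotone_sign_change (R : realType) (f : R -> R) :
  {in `[0, 1] &, {homo f : x y / x <= y}} ->
  exists c, [/\ 0 <= c <= 1,
    forall x, 0 <= x < c -> f x <= 0 & forall x, c < x <= 1 -> 0 <= f x].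
Proof.
move=> f_incr.
(* The sign change is the supremum of the points where [f] is negative; adding [0] keeps the set
   nonempty when [f] is nonnegative throughout. *)
pose S := [set x | x = 0 \/ 0 <= x <= 1 /\ f x < 0].
have S0 : S 0 by left.
have S1 : ubound S 1 by move=> x [->|[/andP[]]]; rewrite ?ler01.
have hsS : has_sup S by split; [exists 0|exists 1].
exists (sup S); split.
- by rewrite ub_le_sup //=; [apply: ge_sup => //; exists 0|exists 1].
- move=> x /andP[x0 xS].
  have [y Sy xy] := sup_gt (ex_intro _ 0 S0) xS.
  case: Sy => [y0|[/andP[y0 y1] fy]]; first by lra.
  apply/ltW/(le_lt_trans _ fy)/f_incr; rewrite ?in_itv /=; lra.
- move=> x /andP[Sx x1].
  have x0 : 0 <= x by apply/(le_trans _ (ltW Sx))/ub_le_sup => //; exists 1.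
  rewrite leNgt; apply/negP => fx.
  suff : x <= sup S by rewrite leNgt Sx.
  by apply: ub_le_sup; [exists 1|right; rewrite x0 x1].
Qed.

(** Both the bounds by constants and the support-line bound on integrals come from this comparison.
    Finite measure makes the constant [a] integrable. *)
Lemma le_affine_Rintegral d (T : measurableType d) (R : realType)
  (mu : {measure set T -> \bar R}) (D : set T) (f g : T -> R) (a b : R) :
  measurable D -> (mu D < +oo)%E ->
  mu.-integrable D (EFin \o f) -> mu.-integrable D (EFin \o g) ->
  (forall x, D x -> a + b * f x <= g x) ->
  a * fine (mu D) + b * \int[mu]_(x in D) f x <= \int[mu]_(x in D) g x.
Proof.
move=> mD Dfin intf intg fg.
have inta : mu.-integrable D (EFin \o cst a).
  apply: measurable_bounded_integrable => //.
  by exists `|a|; split; [rewrite num_real|move=> B aB x _; exact: ltW].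
have intbf : mu.-integrable D (EFin \o (fun x => b * f x)).
  by have := integrableZl mD b intf; apply: eq_integrable.
rewrite -Rintegral_cst // -RintegralZl // -RintegralD //.
apply: le_Rintegral => //.
by have := integrableD mD inta intbf; apply: eq_integrable.
Qed.

Lemma fine_lebesgue_measure_itv (R : realType) (b1 b2 : bool) (x y : R) :
  x <= y ->
  fine (@lebesgue_measure R [set` Interval (BSide b1 x) (BSide b2 y)]) = y - x.
Proof.
move=> xy; rewrite lebesgue_measure_itv /= lte_fin.
case: ltP => //= yx; lra.
Qed.

Lemma le_affine_Rintegral_itv (R : realType) (b1 b2 : bool) (x y : R)
  (f g : R -> R) (a b : R) :
  let mu := @lebesgue_measure R in
  let D := [set` Interval (BSide b1 x) (BSide b2 y)] in
  x <= y ->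
  mu.-integrable D (EFin \o f) -> mu.-integrable D (EFin \o g) ->
  (forall z, D z -> a + b * f z <= g z) ->
  a * (y - x) + b * \int[mu]_(z in D) f z <= \int[mu]_(z in D) g z.
Proof.
move=> mu D xy intf intg fg.
rewrite -(@fine_lebesgue_measure_itv _ b1 b2) //.
apply: le_affine_Rintegral => //.
by rewrite /= lebesgue_measure_itv /=; case: ifP => _; rewrite ?ltry // -EFinB ltry.
Qed.

Lemma Rintegral_itv_ge (R : realType) (b1 b2 : bool) (x y : R)
  (f : R -> R) (k : R) :
  let mu := @lebesgue_measure R in
  let D := [set` Interval (BSide b1 x) (BSide b2 y)] in
  x <= y -> mu.-integrable D (EFin \o f) -> (forall z, D z -> k <= f z) ->
  k * (y - x) <= \int[mu]_(z in D) f z.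
Proof.
move=> mu D xy f_int kf; rewrite -[leLHS]addr0 -(mul0r (\int[mu]_(z in D) f z)).
by apply: le_affine_Rintegral_itv => // z /kf; rewrite mul0r addr0.
Qed.

Lemma Rintegral_itv_le (R : realType) (b1 b2 : bool) (x y : R)
  (f : R -> R) (k : R) :
  let mu := @lebesgue_measure R in
  let D := [set` Interval (BSide b1 x) (BSide b2 y)] in
  x <= y -> mu.-integrable D (EFin \o f) -> (forall z, D z -> f z <= k) ->
  \int[mu]_(z in D) f z <= k * (y - x).
Proof.
move=> mu D xy f_int fk.
(* The affine bound with [g := f] and slope [2] reads [- k (y - x) + 2 I <= I]. *)
have fkf z : D z -> - k + 2 * f z <= f z by move=> /fk; lra.
by have := le_affine_Rintegral_itv xy f_int f_int fkf; rewrite -/mu -/D; lra.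
Qed.

(** Arguments of opposite sign are compared through [phi 0 = 0], negative ones by reflection.
    Monotonicity on the whole line is wanted because [x * f x] takes both signs. *)
Lemma odd_nondecreasing (R : realType) (phi : R -> R) :
  (forall x, phi (- x) = - phi x) ->
  {in `[0, +oo[ &, {homo phi : x y / x <= y}} ->
  {homo phi : x y / x <= y}.
Proof.
move=> phi_odd phi_incr.
have phi0 : phi 0 = 0 by have := phi_odd 0; rewrite oppr0; lra.
have incr x y : 0 <= x -> x <= y -> phi x <= phi y.
  by move=> x0 xy; apply: phi_incr => //; rewrite in_itv /= andbT; lra.
move=> x y xy; have [x0|x0] := leP 0 x; first exact: incr.
have := phi_odd x; have := phi_odd y; have [y0|y0] := leP 0 y => phiN phiN'.
- have := incr _ _ (lexx 0) y0.
  have := incr 0 (- x) (lexx 0) ltac:(lra); lra.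
- have := incr (- y) (- x) ltac:(lra) ltac:(lra); lra.
Qed.

(** The composite is measurable since a monotone [phi] is, and bounded: monotonicity of [f] gives
    [|x * f x| <= |f 0| + |f 1|], and [phi] of this bound controls both signs by oddness. *)
Lemma integrable_comp_id_mul (R : realType) (f phi : R -> R) :
  let mu := @lebesgue_measure R in
  {in `[0, 1] &, {homo f : x y / x <= y}} ->
  mu.-integrable `[0, 1] (EFin \o f) ->
  (forall x, phi (- x) = - phi x) -> {homo phi : x y / x <= y} ->
  mu.-integrable `[0, 1] (EFin \o (fun x => phi (x * f x))).
Proof.
move=> mu f_incr f_int phi_odd phi_incr.
apply: measurable_bounded_integrable => //.
- by rewrite /= lebesgue_measure_itv /= lte_fin ltr01 -EFinB ltry.
- apply: (@measurableT_comp _ _ _ _ _ _ phi).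
    exact: nondecreasing_measurable.
  apply: measurable_funM => //.
  by apply/measurable_EFinP; case/integrableP: f_int.
pose B := `|f 0| + `|f 1|.
exists (phi B); split; first by rewrite num_real.
move=> b phib x /=; rewrite in_itv /= => /andP[x0 x1].
apply: le_trans (ltW phib).
have f0x : f 0 <= f x by apply: f_incr => //; rewrite in_itv /=; lra.
have fx1 : f x <= f 1 by apply: f_incr => //; rewrite in_itv /=; lra.
have xfB : `|x * f x| <= B.
  have fxB : `|f x| <= B.
    have := ler_norm (f 1); have := ler_norm (- f 0); rewrite normrN.
    have := normr_ge0 (f 0); have := normr_ge0 (f 1).
    by rewrite /B ler_norml; lra.
  by rewrite normrM -[B]mul1r ler_pM // ger0_norm.
move: xfB; rewrite !ler_norml => /andP[xfB1 xfB2].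
by rewrite -phi_odd !phi_incr.
Qed.

Theorem theorem3 (R : realType) (f phi : R -> R)
  (f_incr : {in `[0, 1] &, {homo f : x y / x <= y}})
  (f_int : (@lebesgue_measure R).-integrable `[0, 1] (fun x => (f x)%:E))
  (f_int0 : (\int[@lebesgue_measure R]_(x in `[0%R, 1%R]) (f x)%:E = 0)%E)
  (phi_odd : forall x : R, phi (- x) = - phi x)
  (phi_incr : {in `[0, +oo[ &, {homo phi : x y / x <= y}})
  (phi_convex : convex_function (`[0, +oo[%classic : set R) phi) :
  (0 <= \int[@lebesgue_measure R]_(x in `[0%R, 1%R]) (phi (x * f x)%R)%:E)%E.
Proof.
set mu := @lebesgue_measure R.
have {phi_incr} phi_incr := odd_nondecreasing phi_odd phi_incr.
have phi0 : phi 0 = 0 by have := phi_odd 0; rewrite oppr0; lra.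
have phi_ge0 y : 0 <= y -> 0 <= phi y by rewrite -{2}phi0; exact: phi_incr.
pose g x := phi (x * f x).
have g_int : mu.-integrable `[0, 1] (EFin \o g).
  exact: integrable_comp_id_mul.
suff : 0 <= \int[mu]_(x in `[0, 1]) g x.
  rewrite /Rintegral -lee_fin fineK //.
  exact: integrable_fin_num.
have {f_int0} f_int0 : \int[mu]_(x in `[0, 1]) f x = 0 by rewrite /Rintegral f_int0.
have sub_int h (b1 b2 : bool) (x y : R) : 0 <= x -> y <= 1 ->
    mu.-integrable `[0, 1] (EFin \o h) ->
    mu.-integrable [set` Interval (BSide b1 x) (BSide b2 y)] (EFin \o h).
  move=> x0 y1 h_int; apply: integrableS h_int => //.
  by apply: subset_itv; rewrite !bnd_simp //; case: b1; case: b2.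
have split_int h x : 0 <= x <= 1 -> mu.-integrable `[0, 1] (EFin \o h) ->
    \int[mu]_(t in `[0, 1]) h t =
    \int[mu]_(t in `[0, x]) h t + \int[mu]_(t in `]x, 1]) h t.
  move=> /andP[x0 x1] h_int; rewrite -(Rintegral_itvB h_int) ?bnd_simp //.
  by rewrite addrC subrK.
have [c [/andP[c0 c1] f_le0 f_ge0]] := monotone_sign_change f_incr.
pose M := \int[mu]_(x in `]c, 1]) f x.
have M0 : 0 <= M.
  apply: Rintegral_ge0 => x /=; rewrite in_itv /=; exact: f_ge0.
pose q := Num.max c (1 - c).
have cq : c <= q by rewrite le_max lexx.
have cq1 : 1 - c <= q by rewrite le_max lexx orbT.
have q1 : q <= 1 by rewrite ge_max c1; lra.
have q0 : 0 <= q := le_trans c0 cq.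
(* Since [q] is [c] or [1 - c], one factor vanishes; this handles both cases at once in [qN]. *)
have q_eq : (q - c) * (1 - q - c) = 0.
  by rewrite /q; case: leP => _; ring.
have split_int2 h x y : 0 <= x -> x <= y -> y <= 1 ->
    mu.-integrable `[0, 1] (EFin \o h) ->
    \int[mu]_(t in `]x, 1]) h t =
    \int[mu]_(t in `]x, y]) h t + \int[mu]_(t in `]y, 1]) h t.
  move=> x0 xy y1 h_int.
  have hx1 : mu.-integrable `]x, 1] (EFin \o h) by exact: sub_int.
  by rewrite -(@Rintegral_itvB _ _ _ _ y hx1) ?bnd_simp // addrC subrK.
have f_incr' x y : 0 <= x -> x <= y -> y <= 1 -> f x <= f y.
  by move=> x0 xy y1; apply: f_incr => //; rewrite in_itv /=; lra.
have g_left x : 0 <= x <= c -> - phi M <= g x.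
  move=> /andP[x0 xc]; have x1 := le_trans xc c1.
  rewrite -phi_odd; apply: phi_incr.
  (* For [f x < 0], the integral of [f] over [[0, x]] is at most [x * f x] and the one over []x, 1]]
     at most [M], while the two add up to zero. *)
  have [fx|fx] := leP 0 (f x); first by have := mulr_ge0 x0 fx; lra.
  have x01 : 0 <= x <= 1 by rewrite x0.
  have := split_int f x x01 f_int; rewrite f_int0.
  have : \int[mu]_(t in `[0, x]) f t <= f x * (x - 0).
    apply: Rintegral_itv_le => //; first exact: sub_int.
    by move=> z /=; rewrite in_itv /= => /andP[z0 zx]; exact: f_incr'.
  have : \int[mu]_(t in `]x, 1]) f t <= M.
    move: xc; rewrite le_eqVlt => /predU1P[-> //|xc].
    rewrite (split_int2 f x c) // ?(ltW xc) // gerDr.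
    (* The endpoint [c] is dropped because the sign of [f c] is unknown. *)
    rewrite -Rintegral_itv_bndo_bndc; last exact: sub_int.
    rewrite -(mul0r (c - x)).
    apply: Rintegral_itv_le; [exact: ltW|exact: sub_int|].
    move=> z /=; rewrite in_itv /= => /andP[xz zc].
    by apply: f_le0; lra.
  lra.
have [s [s0 s_phi s_supp]] : exists s, [/\ 0 <= s, 0 <= s * M - phi M &
    forall y, 0 <= y -> phi M + s * (y - M) <= phi y].
  (* A support line from convexity requires an interior point. At [M = 0] the slope [0] works, as
     [phi] is nonnegative on the half-line. *)
  have [M_gt0|M_le0] := ltP 0 M; last first.
    have -> : M = 0 by lra.
    by exists 0; split=> [||y y0]; rewrite ?phi0 ?mul0r ?subr0 ?addr0 ?phi_ge0.
  have [s s_supp] := convex_function_support phi_convex M_gt0.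
  have s_phi : phi M <= s * M by have := s_supp 0 (lexx 0); rewrite phi0; lra.
  exists s; split; [|by rewrite subr_ge0|exact: s_supp].
  by rewrite -(pmulr_lge0 _ M_gt0); exact: le_trans (phi_ge0 _ M0) s_phi.
pose N := \int[mu]_(t in `]q, 1]) f t.
(* With [I] the integral over []c, q]], [q * N - c * M = (q - c) * N - c * I]. Bounding [N] below
   and [I] above through [f q] leaves [f q * (q - c) * (1 - q - c)], which is zero by [q_eq]. *)
have qN : c * M <= q * N.
  have M_eq : M = \int[mu]_(t in `]c, q]) f t + N by apply: split_int2.
  have Nge : f q * (1 - q) <= N.
    apply: Rintegral_itv_ge; [by []|exact: sub_int|].
    move=> z /=; rewrite in_itv /= => /andP[qz z1].
    by apply: f_incr' => //; exact: ltW.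
  have Ile : \int[mu]_(t in `]c, q]) f t <= f q * (q - c).
    apply: Rintegral_itv_le; [by []|exact: sub_int|].
    move=> z /=; rewrite in_itv /= => /andP[cz zq].
    by apply: f_incr' => //; lra.
  have qc : 0 <= q - c by lra.
  rewrite M_eq -subr_ge0.
  have := ler_wpM2l qc Nge; have := ler_wpM2l c0 Ile.
  have : (q - c) * (f q * (1 - q)) - c * (f q * (q - c)) = 0.
    by rewrite -(mulr0 (f q)) -q_eq; ring.
  lra.
have J1 : - phi M * (c - 0) <= \int[mu]_(t in `[0, c]) g t.
  apply: Rintegral_itv_ge; [by []|exact: sub_int|].
  by move=> z /=; rewrite in_itv /=; exact: g_left.
have J2 : 0 <= \int[mu]_(t in `]c, q]) g t.
  apply: Rintegral_ge0 => z /=; rewrite in_itv /= => /andP[cz zq].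
  by apply: phi_ge0; rewrite mulr_ge0 ?f_ge0 //; lra.
have J3 : (phi M - s * M) * (1 - q) + s * q * N <= \int[mu]_(t in `]q, 1]) g t.
  apply: le_affine_Rintegral_itv; [by []|exact: sub_int|exact: sub_int|].
  move=> z /=; rewrite in_itv /= => /andP[qz z1].
  have fz : 0 <= f z by apply: f_ge0; lra.
  have qfz : q * f z <= z * f z by rewrite ler_wpM2r // ltW.
  have := s_supp (q * f z) (mulr_ge0 q0 fz).
  by have := phi_incr _ _ qfz; rewrite -/(g z); lra.
rewrite (split_int g c) ?c0 // (split_int2 g c q) //.
apply: le_trans (lerD J1 (lerD J2 J3)).
(* The three bounds add up to [(c + q - 1) * (s * M - phi M) + s * (q * N - c * M)], whose two terms
   are nonnegative by [gap1] and [gap2]. *)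
have cq0 : 0 <= c + q - 1 by lra.
have gap1 := mulr_ge0 cq0 s_phi; have gap2 := ler_wpM2l s0 qN.
clearbody M N q; clear -gap1 gap2; lra.
Qed.
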